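(* Let $G_1$ and $G_2$ be two finite abelian groups with the same order, with $G_2$ acting trivially on $G_1$, and let $\varepsilon_1,\varepsilon_2\in Z^2(G_2,G_1)$. The groups $G_1\underset{\varepsilon_1}{\times}G_2$ and $G_1\underset{\varepsilon_2}{\times}G_2$ are $(G_2)$-isomorphic if and only if $\varepsilon_1=1$ and there exists an isomorphism $\delta:G_1\to G_2$ such that $\varepsilon_2^{-1}\circ(\delta\times\delta)\in B^2(G_1,G_1)$.
   Context: Groups are written multiplicatively; $1$ also denotes the constant map with value $1$. For a group $H$ acting trivially on an abelian group $K$, $Z^2(H,K)$ is the group of normalized 2-cocycles: maps $\varepsilon:H\times H\to K$ with $\varepsilon(h,g)\varepsilon(hg,k)=\varepsilon(g,k)\varepsilon(h,gk)$ for all $g,h,k\in H$ and $\varepsilon(g,1)=\varepsilon(1,g)=1$ for all $g\in H$; $B^2(H,K)$ is its subgroup of maps of the form $(h,g)\mapsto d(g)d(hg)^{-1}d(h)$ for some map $d:H\to K$. $\varepsilon_2^{-1}$ denotes the pointwise inverse of $\varepsilon_2$. For $\varepsilon\in Z^2(G_2,G_1)$, the central extension $G_1\underset{\varepsilon}{\times}G_2$ is the set $G_1\times G_2$ with the group operation $(x,y)(x',y')=(xx'\varepsilon(y,y'),yy')$. For a homomorphism $\varphi:G_1\underset{\varepsilon_1}{\times}G_2\to G_1\underset{\varepsilon_2}{\times}G_2$ put $\varphi_{ij}=pr_i\circ\varphi\circ t_j:G_j\to G_i$, where $pr_i$ is the projection onto the $i$-th coordinate and $t_1(x)=(x,1)$,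 $t_2(y)=(1,y)$. The two groups are called $(G_i)$-isomorphic if there exists an isomorphism $\varphi$ from $G_1\underset{\varepsilon_1}{\times}G_2$ to $G_1\underset{\varepsilon_2}{\times}G_2$ such that $\varphi_{ii}=1$. *)

(* Defs.v *)
From HB Require Import structures.
From mathcomp Require Import all_boot all_fingroup.

Set Implicit Arguments.
Unset Strict Implicit.
Unset Printing Implicit Defensive.

Local Open Scope group_scope.

(* Membership in Z^2(H, K), for the trivial action of H on K (K abelian). *)
Definition is_cocycle2 (H K : finGroupType) (e : H -> H -> K) : Prop :=
  (forall h g k : H, e h g * e (h * g) k = e g k * e h (g * k)) /\
  (forall g : H, e g 1 = 1 /\ e 1 g = 1).

Record cocycle2 (H K : finGroupType) := Cocycle2 {
  cocycle2_fun :> H -> H -> K;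
  cocycle2P : is_cocycle2 cocycle2_fun
}.

(* B^2(H, K) is a subgroup of the group of normalized cocycles, hence the first
   conjunct (it forces d 1 = 1 in the second one). *)
Definition is_coboundary2 (H K : finGroupType) (f : H -> H -> K) : Prop :=
  is_cocycle2 f /\
  exists d : H -> K, forall h g : H, f h g = d g * (d (h * g))^-1 * d h.

(* The central extension G1 x_e G2. It is an alias of G1 * G2, so that its group
   structure is not the direct product one; commutativity of G1 is a parameter
   because the group axioms depend on it. *)
Definition cext (G1 G2 : finGroupType) (abG1 : abelian [set: G1])
  (e : cocycle2 G2 G1) : Type := (G1 * G2)%type.

Section CentralExtension.
Context (G1 G2 : finGroupType) (abG1 : abelian [set: G1]) (e : cocycle2 G2 G1).
Local Notation E := (cext abG1 e).

HB.instance Definition _ := Finite.copy E (G1 * G2)%type.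

Definition cext_mul (u v : E) : E :=
  (u.1 * v.1 * e u.2 v.2, u.2 * v.2).
Definition cext_one : E := (1, 1).
Definition cext_inv (u : E) : E := ((u.1 * e u.2^-1 u.2)^-1, u.2^-1).

Lemma cext_mulgC (x y : G1) : x * y = y * x.
Proof. by apply: (centsP abG1); rewrite inE. Qed.

Lemma cext_mulA : associative cext_mul.
Proof.
have [cE _] := cocycle2P e.
move=> [x y] [x' y'] [x'' y'']; rewrite /cext_mul /=; congr (_, _); last exact: mulgA.
rewrite -!mulgA; congr (_ * (_ * _)).
by rewrite [RHS]mulgA [e y y' * x'']cext_mulgC -mulgA cE.
Qed.

Lemma cext_mul1 : left_id cext_one cext_mul.
Proof.
have [_ nE] := cocycle2P e.
by move=> [x y]; rewrite /cext_mul /= !mul1g (nE y).2 mulg1.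
Qed.

Lemma cext_mulV : left_inverse cext_one cext_inv cext_mul.
Proof.
move=> [x y]; rewrite /cext_mul /cext_inv /cext_one /= mulVg; congr (_, _).
by rewrite -mulgA mulVg.
Qed.

HB.instance Definition _ :=
  Finite_isGroup.Build E cext_mulA cext_mul1 cext_mulV.

Definition cext_pr2 (u : E) : G2 := u.2.
Definition cext_t2 (y : G2) : E := (1, y).

End CentralExtension.

Definition comp22 (G1 G2 : finGroupType) (abG1 : abelian [set: G1])
    (e1 e2 : cocycle2 G2 G1) (phi : cext abG1 e1 -> cext abG1 e2) : G2 -> G2 :=
  fun y => cext_pr2 (phi (cext_t2 abG1 e1 y)).

(* (G_2)-isomorphic: here phi_22 = 1 means constant with value 1. *)
Definition G2_isomorphic (G1 G2 : finGroupType) (abG1 : abelian [set: G1])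
    (e1 e2 : cocycle2 G2 G1) : Prop :=
  exists phi : {morphism [set: cext abG1 e1] >-> cext abG1 e2},
    isom [set: cext abG1 e1] [set: cext abG1 e2] phi /\
    forall y : G2, comp22 phi y = 1.

(* Main.v *)
Require Import Defs.
From mathcomp Require Import all_boot all_fingroup.

(** Write t1 x = (x, 1), t2 y = (1, y), so that (x, y) = t1 x * t2 y in any
    central extension.  Saying that the (2,2) component of a homomorphism phi
    vanishes means that phi (t2 y) = (a y, 1) for some a : G2 -> G1, so the
    second coordinate of phi (x, y) is that of phi (t1 x): it depends on x
    alone, and defines a homomorphism delta : G1 -> G2.

    If phi is onto, then so is delta, hence delta is bijective because G1 and G2
    have the same order.  Since t2 y * t2 y' = t1 (e1 y y') * t2 (y y') and phi
    sends every t2 into the kernel of the second projection, delta kills all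
    the values of e1; so e1 = 1.  Finally phi (t1 x) = (b x, delta x), and the
    first coordinate of phi (t1 x) * phi (t1 x') = phi (t1 (x * x')) reads
    b x * b x' * e2 (delta x) (delta x') = b (x * x'), which exhibits the inverse
    of e2 o (delta x delta) as the coboundary of b.

    Conversely, if this inverse is the coboundary of b and e1 = 1, the map
    (x, y) |-> (b x * delta^-1 y, delta x) is an injective homomorphism, by the
    same identity, and a bijection by counting.  Its (2,2) component vanishes
    because delta 1 = 1. *)

Set Implicit Arguments.
Unset Strict Implicit.

Local Open Scope group_scope.

Section Extension.

Variables (G1 G2 : finGroupType) (abG1 : abelian [set: G1]).
Implicit Types e : cocycle2 G2 G1.

Definition cext_t1 e (x : G1) : cext abG1 e := (x, 1).

Lemma cext_mulE e (u v : cext abG1 e) :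
  u * v = (u.1 * v.1 * e u.2 v.2, u.2 * v.2).
Proof. by []. Qed.

Lemma cext_t1M e : {morph cext_t1 e : x x' / x * x'}.
Proof.
by move=> x x'; rewrite cext_mulE /= ((cocycle2P e).2 1).1 !mulg1.
Qed.

Lemma cext_t1t2E e (u : cext abG1 e) :
  u = cext_t1 e u.1 * cext_t2 abG1 e u.2.
Proof.
by case: u => x y; rewrite cext_mulE /= ((cocycle2P e).2 y).2 !mulg1 mul1g.
Qed.

Lemma cext_t2M e (y y' : G2) :
  cext_t2 abG1 e y * cext_t2 abG1 e y'
    = cext_t1 e (e y y') * cext_t2 abG1 e (y * y').
Proof. by rewrite cext_mulE [RHS]cext_mulE /= ((cocycle2P e).2 _).2 !mulg1 !mul1g. Qed.

(** The cocycle identity survives pointwise inversion because G1 is abelian,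
    and pullback because delta is multiplicative. *)
Lemma cocycle2V_comp e (delta : {morphism [set: G1] >-> G2}) :
  is_cocycle2 (fun x x' : G1 => (e (delta x) (delta x'))^-1).
Proof.
have [cE nE] := cocycle2P e; split=> [h g k | g].
  rewrite -!invMg !morphM ?inE //; congr (_^-1).
  by rewrite (cext_mulgC abG1) cE (cext_mulgC abG1).
by rewrite morph1 (nE _).1 (nE _).2 invg1.
Qed.

Section Necessity.

Variables (e1 e2 : cocycle2 G2 G1).
Variable phi : {morphism [set: cext abG1 e1] >-> cext abG1 e2}.
Hypothesis phi22 : forall y, comp22 phi y = 1.

(** The component phi_21, which is the delta of the theorem. *)
Definition comp21 (x : G1) : G2 := (phi (cext_t1 e1 x)).2.

Lemma comp21M : {in [set: G1] &, {morph comp21 : x x' / x * x'}}.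
Proof. by move=> x x' _ _; rewrite /comp21 cext_t1M morphM ?inE. Qed.

Canonical comp21_morphism := Morphism comp21M.

(** Both factors of the decomposition u = t1 u.1 * t2 u.2 are mapped separately,
    and the second one goes to the kernel of the second projection. *)
Lemma pr2_phiE u : (phi u).2 = comp21 u.1.
Proof.
rewrite {1}[u]cext_t1t2E morphM ?inE // cext_mulE /=.
by move: (phi22 u.2); rewrite /comp22 /cext_pr2 => ->; rewrite mulg1.
Qed.

(** In t2 y * t2 y' = t1 (e1 y y') * t2 (y * y'), every t2 goes to the kernel of
    the second projection, so the remaining factor does too. *)
Lemma comp21_cocycle1 (y y' : G2) : comp21 (e1 y y') = 1.
Proof.
have := pr2_phiE (cext_t2 abG1 e1 y * cext_t2 abG1 e1 y').
rewrite morphM ?inE // !cext_mulE /= !mul1g => <-.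
by have := phi22 y; have := phi22 y'; rewrite /comp22 /cext_pr2 => -> ->; rewrite mulg1.
Qed.

(** The cochain is the component phi_11: the first coordinate of
    phi (x, 1) * phi (x', 1) = phi (x * x', 1) is the coboundary equation. *)
Lemma comp21_coboundary :
  is_coboundary2 (fun x x' : G1 => (e2 (comp21 x) (comp21 x'))^-1).
Proof.
split; first exact: (cocycle2V_comp e2 comp21_morphism).
exists (fun x => (phi (cext_t1 e1 x)).1) => x x'.
rewrite cext_t1M morphM ?inE // cext_mulE /= -/(comp21 x) -/(comp21 x').
rewrite invMg (cext_mulgC abG1 (e2 _ _)^-1) invMg -!mulgA mulKVg.
by rewrite (cext_mulgC abG1 (e2 _ _)^-1) mulKg.
Qed.

Lemma comp21_isom : #|G1| = #|G2| ->
  isom [set: cext abG1 e1] [set: cext abG1 e2] phi ->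
  isom [set: G1] [set: G2] comp21.
Proof.
move=> eqG12 /isomP[_ im_phi].
have im21 : comp21 @* [set: G1] = [set: G2].
  apply/eqP; rewrite eqEsubset subsetT; apply/subsetP=> z _.
  have: (1, z) \in phi @* [set: cext abG1 e1] by rewrite im_phi inE.
  case/morphimP=> u _ _ /(congr1 snd) /= ->.
  by rewrite pr2_phiE mem_morphim ?inE.
apply/isomP; split=> //.
by rewrite -card_im_injm im21 !cardsT eqG12.
Qed.

End Necessity.

Lemma G2_isomorphic_of_coboundary (eqG12 : #|G1| = #|G2|) (e1 e2 : cocycle2 G2 G1)
    (delta : {morphism [set: G1] >-> G2}) :
    (forall y y', e1 y y' = 1) -> isom [set: G1] [set: G2] delta ->
    is_coboundary2 (fun x x' : G1 => (e2 (delta x) (delta x'))^-1) ->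
  G2_isomorphic abG1 e1 e2.
Proof.
move=> e1E /isomP[/injmP inj_delta _] [_ [b bE]].
have injd : injective delta by move=> x x'; apply: inj_delta; rewrite inE.
have [g deltaK gK] : bijective delta by apply: inj_card_bij; rewrite ?eqG12.
have gM : {morph g : y y' / y * y'}.
  by move=> y y'; apply: injd; rewrite morphM ?inE // !gK.
pose f (u : cext abG1 e1) : cext abG1 e2 := (b u.1 * g u.2, delta u.1).
have fM : {in [set: cext abG1 e1] &, {morph f : u v / u * v}}.
  move=> [x y] [x' y'] _ _; rewrite !cext_mulE /f /= e1E mulg1 morphM ?inE //.
  congr (_, _); rewrite gM.
  (* The coboundary equation, solved for b (x * x'). *)
  have -> : b (x * x') = b x * b x' * e2 (delta x) (delta x').
    rewrite -[e2 _ _]invgK bE !invMg invgK.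
    rewrite (cext_mulgC abG1 (b x)) -!mulgA (mulgA (b x)) mulgV mul1g.
    by rewrite (cext_mulgC abG1 (b (x * x'))) mulKVg.
  rewrite -!mulgA; congr (_ * _).
  rewrite (cext_mulgC abG1 (e2 _ _)) !mulgA; congr (_ * _ * _).
  exact: cext_mulgC.
have injf : 'injm (Morphism fM).
  apply/injmP=> -[x y] [x' y'] _ _ /= [] /[swap] /injd <- /mulgI.
  by move/(can_inj gK)=> <-.
exists (Morphism fM); split; last by move=> y; rewrite /comp22 /cext_pr2 /= morph1.
apply/isomP; split=> //; apply/eqP; rewrite eqEcard subsetT card_injm //.
(* The two extensions have the same underlying set. *)
rewrite !cardsT; exact: leqnn.
Qed.

End Extension.

Unset Implicit Arguments.
Set Strict Implicit.

Theorem corollary6p3 (G1 G2 : finGroupType)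
    (abG1 : abelian [set: G1]) (abG2 : abelian [set: G2])
    (eqG12 : #|G1| = #|G2|) (e1 e2 : cocycle2 G2 G1) :
  G2_isomorphic abG1 e1 e2 <->
  (forall y y' : G2, e1 y y' = 1) /\
  (exists delta : {morphism [set: G1] >-> G2},
     isom [set: G1] [set: G2] delta /\
     is_coboundary2 (fun x x' : G1 => (e2 (delta x) (delta x'))^-1)).
Proof.
split=> [[phi [iso_phi phi22]] | [e1E [delta [iso_delta cob]]]]; last first.
  exact: G2_isomorphic_of_coboundary cob.
have iso21 := comp21_isom phi22 eqG12 iso_phi.
split; last first.
  by exists (comp21_morphism phi); split; [| exact: comp21_coboundary].
move=> y y'; have /isomP[/injmP inj21 _] := iso21.
by apply: inj21; rewrite ?inE // morph1 /= comp21_cocycle1.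
Qed.
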